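(* Let $n,m\ge 1$ be integers and let $A\in\mathbb{R}^{(n+m)\times(n+m)}$. Then $A$ is a doubly stochastic block matrix (with respect to the block sizes $n,m$), i.e. $A=A_1\oplus A_2$ for some doubly stochastic matrices $A_1\in\mathbb{R}^{n\times n}$ and $A_2\in\mathbb{R}^{m\times m}$, if and only if $$(Au)^\natural \prec^{*} u^\natural \quad\text{for all } u\in\mathbb{R}^n\times\mathbb{R}^m .$$
   Context: For a real vector $x$, $x^{\downarrow}$ denotes the vector obtained from $x$ by rearranging its coordinates in non-increasing order. For $u=(x,y)\in\mathbb{R}^n\times\mathbb{R}^m=\mathbb{R}^{n+m}$ (regarded as a column vector when multiplied by a matrix), $u^\natural:=(x^{\downarrow},y^{\downarrow})\in\mathbb{R}^{n+m}$ denotes the non-increasing block order: each of the two blocks (the first $n$ and the last $m$ coordinates) is sorted separately in non-increasing order and the results are concatenated. In particular, $(Au)^\natural$ is obtained by splitting $Au$ into its first $n$ and last $m$ coordinates and sorting each block in non-increasing order. For vectors $a,b\in\mathbb{R}^{p}$ written in the displayed order (with no further rearrangement), $a\prec^{*}b$ ($*$-majorization) means $\sum_{i=1}^k a_i\le\sum_{i=1}^k b_i$ for $k=1,\dots,p$, with equality for $k=p$. A square real matrix is doubly stochastic if its entries are nonnegative and all its row sums and column sums equal $1$. $A_1\oplus A_2$ denotes the block diagonal matrix with diagonal blocks $A_1,A_2$. *)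

(* Defs.v *)
From mathcomp Require Import all_boot all_order all_algebra.

Set Implicit Arguments.
Unset Strict Implicit.
Unset Printing Implicit Defensive.

Import Order.TTheory GRing.Theory Num.Theory.

Local Open Scope ring_scope.

Definition doubly_stochastic (R : realDomainType) (p : nat) (A : 'M[R]_p) : Prop :=
  [/\ forall i j, 0 <= A i j,
      forall i, \sum_(j < p) A i j = 1
    & forall j, \sum_(i < p) A i j = 1].

Definition doubly_stochastic_block (R : realDomainType) (n m : nat)
    (A : 'M[R]_(n + m)) : Prop :=
  exists (A1 : 'M[R]_n) (A2 : 'M[R]_m),
    [/\ doubly_stochastic A1, doubly_stochastic A2
      & A = block_mx A1 0 0 A2].

Definition noninc (R : realDomainType) (p : nat) (x : 'cV[R]_p) : 'cV[R]_p :=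
  \col_(i < p) (sort >=%R [seq x j 0 | j <- enum 'I_p])`_i.

Definition block_noninc (R : realDomainType) (n m : nat)
    (u : 'cV[R]_(n + m)) : 'cV[R]_(n + m) :=
  col_mx (noninc (usubmx u)) (noninc (dsubmx u)).

(* The coordinates of [a] and [b] are summed in the given order, without
   rearrangement; the 1-based partial sum up to [k] is over indices [i < k]. *)
Definition star_majorized (R : realDomainType) (p : nat) (a b : 'cV[R]_p) : Prop :=
  (forall k : nat, (1 <= k <= p)%N ->
     \sum_(i < p | (i < k)%N) a i 0 <= \sum_(i < p | (i < k)%N) b i 0)
  /\ \sum_(i < p) a i 0 = \sum_(i < p) b i 0.

(* Main.v *)
(** Sums over the first [k] coordinates of [block_noninc] split along the two
    blocks. If [A] is a doubly stochastic block matrix, the claim reduces to the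
    Hardy-Littlewood-Polya inequality for each block. Conversely, the partial sum
    up to [n], applied to [u] and [- u], shows that the first blocks of [A u] and
    [u] have the same sum, so majorization holds in each block separately. In
    particular any upper bound of a block of [u] bounds the same block of [A u];
    testing this on [0] in the block, on minus the unit vectors and on plus or
    minus the all-ones vector gives the vanishing of the off-diagonal blocks,
    nonnegativity and the row sums. *)
Require Import Defs.
From mathcomp Require Import all_boot all_order all_algebra reals.
From mathcomp Require Import perm.

Import Order.TTheory GRing.Theory Num.Theory.

Local Open Scope ring_scope.

(** The cutoff [k] is unrestricted, so that a cutoff of a concatenation can be passed to both
    blocks, even when it is 0 or exceeds the length of one of them. *)
Definition psum {R : realDomainType} {p : nat} (k : nat) (a : 'cV[R]_p) : R :=
  \sum_(i < p | (i < k)%N) a i 0.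

Lemma psum0 (R : realDomainType) (p : nat) (a : 'cV[R]_p) : psum 0 a = 0.
Proof. by rewrite /psum big_pred0. Qed.

Lemma psum_ge (R : realDomainType) (p k : nat) (a : 'cV[R]_p) :
  (p <= k)%N -> psum k a = \sum_(i < p) a i 0.
Proof.
by move=> pk; apply: eq_bigl => i; rewrite (leq_trans (ltn_ord i) pk).
Qed.

Lemma psum1 (R : realDomainType) (p : nat) (a : 'cV[R]_p.+1) : psum 1 a = a 0 0.
Proof. by rewrite /psum (big_pred1 0) // => i; rewrite ltnS leqn0. Qed.

Lemma psum_col_mx (R : realDomainType) (n m k : nat)
    (a : 'cV[R]_n) (b : 'cV[R]_m) :
  psum k (col_mx a b) = psum k a + psum (k - n) b.
Proof.
rewrite /psum big_split_ord /=; congr (_ + _).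
  by apply: eq_bigr => i _; rewrite col_mxEu.
by apply: eq_big => i => [|_]; rewrite ?col_mxEd // ltn_subRL.
Qed.

Lemma sum_col_mx (R : realDomainType) (n m : nat)
    (a : 'cV[R]_n) (b : 'cV[R]_m) :
  \sum_i col_mx a b i 0 = \sum_i a i 0 + \sum_i b i 0.
Proof.
by rewrite big_split_ord /=; congr (_ + _); apply: eq_bigr => i _;
  rewrite ?col_mxEu ?col_mxEd.
Qed.

Lemma star_majorizedE (R : realDomainType) (p : nat) (a b : 'cV[R]_p) :
  star_majorized a b <->
  (forall k, psum k a <= psum k b) /\ \sum_i a i 0 = \sum_i b i 0.
Proof.
split=> -[le_ab eq_ab]; split=> // k; last by move=> _; apply: le_ab.
have [->|k_gt0] := posnP k; first by rewrite !psum0.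
have [kp|/ltnW pk] := leqP k p; last by rewrite !psum_ge ?eq_ab.
by apply: le_ab; rewrite k_gt0.
Qed.

(** Up to cutoff [n] the second block contributes nothing; at cutoff [n + k] the first blocks
    contribute equal totals, which cancel. *)
Lemma star_majorized_col_mx (R : realDomainType) (n m : nat)
    (a c : 'cV[R]_n) (b d : 'cV[R]_m) :
  \sum_i a i 0 = \sum_i c i 0 ->
  star_majorized (col_mx a b) (col_mx c d) <->
  star_majorized a c /\ star_majorized b d.
Proof.
move=> eq_ac; rewrite !star_majorizedE !sum_col_mx eq_ac.
split=> [[le_s /addrI eq_bd]|[[le_ac _] [le_bd ->]]]; last first.
  by split=> // k; rewrite !psum_col_mx lerD.
split; split=> // k; last first.
  by have := le_s (n + k)%N; rewrite !psum_col_mx addKn !(psum_ge _ n) ?leq_addr // eq_ac lerD2l.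
have [nk|/ltnW kn] := leqP n k; first by rewrite !psum_ge ?eq_ac.
by have := le_s k; rewrite !psum_col_mx (eqP kn) !psum0 !addr0.
Qed.

Lemma noninc_perm (R : realDomainType) (p : nat) (x : 'cV[R]_p) :
  exists s : 'S_p, forall i, noninc x i 0 = x (s i) 0.
Proof.
have /tuple_permP[s sE] : perm_eq (sort >=%R [seq x j 0 | j <- enum 'I_p])
    [tuple x j 0 | j < p] by rewrite perm_sort.
exists s => i; rewrite mxE sE -tnth_nth !tnth_mktuple //.
Qed.

Lemma noninc_le (R : realDomainType) (p : nat) (x : 'cV[R]_p) (i j : 'I_p) :
  (i <= j)%N -> noninc x j 0 <= noninc x i 0.
Proof.
move=> ij; rewrite !mxE.
apply: (@sorted_leq_nth _ >=%R) => //.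
- exact: ge_trans.
- exact: ge_refl.
- by apply: sort_sorted => a b; apply: ge_total.
- by rewrite inE size_sort size_map size_enum_ord.
- by rewrite inE size_sort size_map size_enum_ord.
Qed.

Lemma sum_noninc (R : realDomainType) (p : nat) (x : 'cV[R]_p) :
  \sum_i noninc x i 0 = \sum_i x i 0.
Proof.
have [s xs] := noninc_perm _ _ x.
by rewrite [RHS](reindex_inj (@perm_inj _ s)); apply: eq_bigr.
Qed.

(** At cutoff 1, majorization compares the largest entries. *)
Lemma noninc_majorized_ub (R : realDomainType) (p : nat) (a x : 'cV[R]_p) (c : R) :
  star_majorized (noninc a) (noninc x) ->
  (forall j, x j 0 <= c) -> forall i, a i 0 <= c.
Proof.
case: p a x => [|p] a x; first by move=> _ _ [].
move=> /star_majorizedE[/(_ 1) le_ax _] xc i; rewrite !psum1 in le_ax.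
have [s aE] := noninc_perm _ _ a; have [t xE] := noninc_perm _ _ x.
(* Entry [i] of [a] stands at position [s^-1 i] of the sorted vector, so the entry at position 0
   bounds it. *)
rewrite -(permKV s i) -aE; apply: le_trans (noninc_le _ _ _ 0 _ _) _ => //.
by rewrite (le_trans le_ax) // xE.
Qed.

Lemma doubly_stochastic_sum (R : realDomainType) (p : nat) (P : 'M[R]_p)
    (x : 'cV[R]_p) :
  (forall j, \sum_i P i j = 1) -> \sum_i (P *m x) i 0 = \sum_i x i 0.
Proof.
move=> col1; under eq_bigr do rewrite mxE.
by rewrite exchange_big /=; apply: eq_bigr => j _; rewrite -mulr_suml col1 mul1r.
Qed.

(** For [k < p], adding the first [k] rows of [D] gives weights [c j] in [0, 1] of total [k]. As [w]
    is non-increasing, the weighted sum is largest when all weight lies on the first [k] entries. *)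
Lemma doubly_stochastic_psum (R : realDomainType) (p k : nat) (D : 'M[R]_p)
    (w : 'cV[R]_p) :
  doubly_stochastic D ->
  (forall i j : 'I_p, (i <= j)%N -> w j 0 <= w i 0) ->
  psum k (D *m w) <= psum k w.
Proof.
move=> [D_ge0 row1 col1] w_le.
have [pk|kp] := leqP p k; first by rewrite !psum_ge ?doubly_stochastic_sum.
(* With indices from 0, this is the first entry outside the partial sum: entries before [k] are at
   least [pivot], the others at most. *)
pose pivot := w (Ordinal kp) 0.
pose c j := \sum_(i < p | (i < k)%N) D i j.
have psumD : psum k (D *m w) = \sum_j c j * w j 0.
  rewrite /psum; under eq_bigr do rewrite mxE.
  by rewrite exchange_big /=; apply: eq_bigr => j _; rewrite -mulr_suml.
have psumw : psum k w = \sum_(j < p) (j < k)%N%:R * w j 0.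
  by rewrite /psum big_mkcond; apply: eq_bigr => j _; case: ltnP => _;
    rewrite ?mul1r ?mul0r.
have sum_c : \sum_j c j = \sum_(j < p) (j < k)%N%:R.
  rewrite exchange_big big_mkcond /=.
  by apply: eq_bigr => i _; rewrite row1; case: ltnP.
have c_ge0 j : 0 <= c j by apply: sumr_ge0.
have c_le1 j : c j <= 1.
  by rewrite -(col1 j) /c big_mkcond; apply: ler_sum => i _; case: ifP.
(* Subtracting [pivot * \sum_j ([j < k] - c j) = 0] makes every term nonnegative. *)
rewrite -subr_ge0 psumD psumw.
have -> : \sum_(j < p) (j < k)%N%:R * w j 0 - \sum_j c j * w j 0 =
          \sum_(j < p) ((j < k)%N%:R - c j) * (w j 0 - pivot).
  under [RHS]eq_bigr do rewrite mulrBr mulrBl.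
  by rewrite !sumrB -[X in _ = _ - X]mulr_suml sumrB sum_c subrr mul0r subr0.
apply: sumr_ge0 => j _; case: ltnP => [jk|kj].
  by rewrite mulr_ge0 ?subr_ge0 // w_le // ltnW.
by rewrite sub0r mulr_le0 ?oppr_le0 // subr_le0 w_le.
Qed.

Lemma doubly_stochastic_majorized (R : realDomainType) (p : nat) (P : 'M[R]_p)
    (x : 'cV[R]_p) :
  doubly_stochastic P -> star_majorized (noninc (P *m x)) (noninc x).
Proof.
move=> [P_ge0 row1 col1]; apply/star_majorizedE.
split=> [k|]; last by rewrite !sum_noninc doubly_stochastic_sum.
have [s PxE] := noninc_perm _ _ (P *m x); have [t xE] := noninc_perm _ _ x.
(* Sorting [x] and [P *m x] only permutes the columns and rows of [P], which keeps it doubly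
   stochastic. *)
pose D := \matrix_(i, j) P (s i) (t j).
have -> : noninc (P *m x) = D *m noninc x.
  apply/colP => i; rewrite PxE !mxE (reindex_inj (@perm_inj _ t)).
  by apply: eq_bigr => j _; rewrite xE mxE.
apply: doubly_stochastic_psum => [|i j]; last exact: noninc_le.
split=> [i j|i|j]; first by rewrite mxE.
- rewrite -(row1 (s i)) [RHS](reindex_inj (@perm_inj _ t)).
  by apply: eq_bigr => j _; rewrite mxE.
- rewrite -(col1 (t j)) [RHS](reindex_inj (@perm_inj _ s)).
  by apply: eq_bigr => i _; rewrite mxE.
Qed.

(** Here [P] is a diagonal block and [Q] the off-diagonal block in the same block row. *)
Lemma majorized_doubly_stochastic (R : realDomainType) (p q : nat)
    (P : 'M[R]_p) (Q : 'M[R]_(p, q)) :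
  (forall x y, star_majorized (noninc (P *m x + Q *m y)) (noninc x)) ->
  doubly_stochastic P /\ Q = 0.
Proof.
move=> maj.
(* The bound depends on [x] alone while [y] stays free; this is what forces [Q = 0]. *)
have ub (x : 'cV_p) y c i : (forall j, x j 0 <= c) -> (P *m x + Q *m y) i 0 <= c.
  by move=> xc; apply: noninc_majorized_ub xc i.
have ubP (x : 'cV_p) c i : (forall j, x j 0 <= c) -> (P *m x) i 0 <= c.
  by move/ub => /(_ 0 i); rewrite mulmx0 addr0.
have PdeltaE i j : (P *m (delta_mx j 0 : 'cV_p)) i 0 = P i j by rewrite -colE mxE.
have PoneE i : (P *m (const_mx 1 : 'cV_p)) i 0 = \sum_j P i j.
  by rewrite mxE; apply: eq_bigr => j _; rewrite mxE mulr1.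
split; last first.
  have ubQ (y : 'cV_q) i : (Q *m y) i 0 <= 0.
    by have := ub 0 y 0 i; rewrite mulmx0 add0r; apply=> j; rewrite mxE.
  apply/matrixP => i j; rewrite [RHS]mxE; apply/le_anti.
  have := ubQ (delta_mx j 0) i; have := ubQ (- delta_mx j 0) i.
  by rewrite mulmxN [X in X <= 0]mxE -colE mxE oppr_le0 => -> ->.
split=> [i j|i|j].
- rewrite -oppr_le0 -PdeltaE.
  have := ubP (- delta_mx j 0) 0 i; rewrite mulmxN [X in X <= 0]mxE; apply=> l.
  by rewrite !mxE oppr_le0 ler0n.
- apply/le_anti/andP; split.
    by rewrite -PoneE; apply: ubP => j; rewrite mxE.
  rewrite -lerN2 -PoneE.
  have := ubP (- const_mx 1) (-1) i; rewrite mulmxN [X in X <= _]mxE; apply=> j.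
  by rewrite !mxE.
(* Column sums come from the equality of totals at a unit vector. *)
- have [_] := maj (delta_mx j 0) 0; rewrite mulmx0 addr0 !sum_noninc.
  under eq_bigr do rewrite PdeltaE; move=> ->.
  by rewrite (bigD1 j) //= big1 ?addr0 => [|i /negPf ij]; rewrite mxE ?ij ?eqxx.
Qed.

(** Sorting does not commute with negation, but the sum of a block does, so the inequality at cutoff
    [n] for [- u] is the reverse of the one for [u]. *)
Lemma block_noninc_majorized_sum (R : realDomainType) (n m : nat)
    (A : 'M[R]_(n + m)) :
  (forall u : 'cV[R]_(n + m),
     star_majorized (block_noninc (A *m u)) (block_noninc u)) ->
  forall u : 'cV[R]_(n + m),
    \sum_i usubmx (A *m u) i 0 = \sum_i usubmx u i 0.
Proof.
move=> maj.
have le_sum (u : 'cV[R]_(n + m)) : \sum_i usubmx (A *m u) i 0 <= \sum_i usubmx u i 0.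
  have /star_majorizedE[/(_ n) + _] := maj u.
  by rewrite !psum_col_mx subnn !psum0 !addr0 !psum_ge // !sum_noninc.
have sumN (v : 'cV[R]_(n + m)) :
    \sum_i usubmx (- v) i 0 = - \sum_i usubmx v i 0.
  by rewrite -sumrN; apply: eq_bigr => i _; rewrite !mxE.
move=> u; apply/le_anti; rewrite le_sum /= -lerN2 -!sumN.
by rewrite -mulmxN le_sum.
Qed.

Theorem theorem1p3 (R : realType) (n m : nat) (hn : (1 <= n)%N) (hm : (1 <= m)%N)
    (A : 'M[R]_(n + m)) :
  doubly_stochastic_block A <->
  (forall u : 'cV[R]_(n + m),
     star_majorized (block_noninc (A *m u)) (block_noninc u)).
Proof.
split=> [[A1 [A2 [ds1 ds2 ->]]] u|maj].
  rewrite -[u]vsubmxK mul_block_col !mul0mx addr0 add0r /block_noninc.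
  rewrite !col_mxKu !col_mxKd.
  apply/star_majorized_col_mx; last by split; apply: doubly_stochastic_majorized.
  by have [_ _ col1] := ds1; rewrite !sum_noninc doubly_stochastic_sum.
(* Each conjunct puts its diagonal block first, so that one lemma serves both block rows with [x]
   and [y] exchanged. *)
have maj_blocks x y :
    star_majorized (noninc (ulsubmx A *m x + ursubmx A *m y)) (noninc x) /\
    star_majorized (noninc (drsubmx A *m y + dlsubmx A *m x)) (noninc y).
  have sumE := block_noninc_majorized_sum _ _ _ _ maj (col_mx x y).
  have := maj (col_mx x y); rewrite /block_noninc star_majorized_col_mx; last first.
    by rewrite !sum_noninc.
  rewrite -{1 2}[A]submxK mul_block_col !col_mxKu !col_mxKd.
  by rewrite [dlsubmx A *m x + _]addrC.
have [ds1 ur0] := majorized_doubly_stochastic _ _ _ _ _ (fun x y => (maj_blocks x y).1).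
have [ds2 dl0] := majorized_doubly_stochastic _ _ _ _ _ (fun y x => (maj_blocks x y).2).
by exists (ulsubmx A), (drsubmx A); split=> //; rewrite -ur0 -{1}dl0 submxK.
Qed.
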